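(* Let $\mathrm{Per}(F_4)$ be the set of periods of the difference equation $x_{n+4}=\max\{x_{n+3},x_{n+2},x_{n+1},0\}-x_n$, $n\ge 1$, with arbitrary real initial conditions. Then $$\mathrm{Per}(F_4)=\{1,8,11\}\cup\{10a+11b \;:\; a,b\in\mathbb{N},\ \gcd(a,b)=1,\ a\ge 1,\ b\ge 2a+1\}.$$
   Context: $\mathbb{N}=\{1,2,3,\dots\}$. A solution is a real sequence $(x_n)_{n\ge 1}$ satisfying the equation for all $n\ge 1$; it is determined by its initial conditions $(x_1,x_2,x_3,x_4)\in\mathbb{R}^4$. A solution is periodic if there is $m\in\mathbb{N}$ with $x_{n+m}=x_n$ for all $n\ge 1$; the smallest such $m$ is called its period. $\mathrm{Per}(F_4)$ is the set of all natural numbers that are the (smallest) period of some periodic solution. *)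

(* Defs.v *)
(* Stdlib world: the classical real numbers R. *)
From Stdlib Require Import Reals.

Open Scope R_scope.

(* Sequences are indexed from 1: a sequence is a function nat -> R whose value
   at 0 is irrelevant, and no condition below mentions that value. *)

Definition is_solution (x : nat -> R) : Prop :=
  forall n : nat, (1 <= n)%nat ->
    x (n + 4)%nat =
      Rmax (Rmax (Rmax (x (n + 3)%nat) (x (n + 2)%nat)) (x (n + 1)%nat)) 0 - x n.

Definition repeats_after (x : nat -> R) (m : nat) : Prop :=
  (1 <= m)%nat /\ forall n : nat, (1 <= n)%nat -> x (n + m)%nat = x n.

Definition is_period (x : nat -> R) (m : nat) : Prop :=
  repeats_after x m /\ forall k : nat, repeats_after x k -> (m <= k)%nat.

Definition Per_F4 (p : nat) : Prop :=
  exists x : nat -> R, is_solution x /\ is_period x p.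

(* Main.v *)
(* Write [D] for the maximal value of a solution.  Every solution reaches a
   state [(D, y1, y2, y3)] with [0 <= y1, y2, y3 <= D].  If [y1 >= y2 >= y3],
   the solution repeats after 11 steps.  Otherwise the state lies on a closed
   curve, determined by [D] and two further constants [0 <= r < s <= D], which
   runs through
     [(D, t, r, s)], [t] from [D] down to [r];
     [(D, r, t, s)], [t] from [r] up to [s];
     [(D, r, s, t)], [t] from [s] down to [0];
   it closes up because [(D, D, r, s)] is followed by [(D, r, s, 0)].
   Parametrised by arc length the curve is a circle of length
   [L = D + 2 (s - r)], and the return map to it is the rotation by [s - r],
   the return taking 11 steps, or 10 steps when the rotation passes the base
   point.  If [(r, s) <> (0, D)] there are no earlier returns, so a period is
   [11 k - w] with [k (s - r) = w L] in lowest terms; with [a = w] and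
   [b = k - w] this is [10 a + 11 b], and [s - r < D] says that [b > 2 a].
   If [(r, s) = (0, D)] the period is 8. *)
Require Import Defs.
From Stdlib Require Import Reals Arith Lra Lia.

(** * Solutions indexed from 0 *)

Definition Rec (y : nat -> R) : Prop :=
  forall i : nat,
    y (i + 4)%nat =
      Rmax (Rmax (Rmax (y (i + 3)%nat) (y (i + 2)%nat)) (y (i + 1)%nat)) 0 - y i.

Definition rep (y : nat -> R) (m : nat) : Prop :=
  (1 <= m)%nat /\ forall i : nat, y (i + m)%nat = y i.

Definition shift (n : nat) (y : nat -> R) : nat -> R := fun i => y (n + i)%nat.

Lemma Rec_shift (n : nat) (y : nat -> R) : Rec y -> Rec (shift n y).
Proof.
  intros H i. unfold shift. rewrite !Nat.add_assoc. apply H.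
Qed.

(** The maximum becomes linear bounds together with a disjunction telling which one is attained. In
    this form [lra] can compute the next term once the order of the earlier ones is known. *)
Lemma Rec_sum_max (y : nat -> R) (i : nat) : Rec y ->
  y (i + 1)%nat <= y (i + 4)%nat + y i /\
  y (i + 2)%nat <= y (i + 4)%nat + y i /\
  y (i + 3)%nat <= y (i + 4)%nat + y i /\
  0 <= y (i + 4)%nat + y i /\
  (y (i + 4)%nat + y i = y (i + 1)%nat \/
   y (i + 4)%nat + y i = y (i + 2)%nat \/
   y (i + 4)%nat + y i = y (i + 3)%nat \/
   y (i + 4)%nat + y i = 0).
Proof.
  intros H. rewrite (H i). unfold Rmax.
  destruct (Rle_dec (y (i + 3)%nat) (y (i + 2)%nat));
    repeat (destruct (Rle_dec _ _)); repeat split; try lra.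
Qed.

Ltac step H i :=
  let B := fresh "B" in
  destruct (Rec_sum_max _ i H) as (? & ? & ? & ? & B); cbn [Nat.add] in *;
  first [lra | destruct B as [B | [B | [B | B]]]; lra].

(** * Rotation of the curve *)

Section Orbits.

Variables (y : nat -> R) (D r s t : R).
Hypotheses (HR : Rec y) (r0 : 0 <= r) (rs : r <= s) (sD : s <= D).

(** The five lemmas of this section follow a point of the curve up to its next return, one for each
    arc on which all terms are fixed linear expressions. Here the point stays on the first leg. The
    intermediate terms are listed for [no_early_return_0]. *)
Lemma orbit_drift_high :
  s <= t -> t <= D -> y 0%nat = D -> y 1%nat = t -> y 2%nat = r -> y 3%nat = s ->
  y 4%nat = t - D /\ y 5%nat = s - t /\ y 6%nat = s - r /\ y 7%nat = - r /\
  y 8%nat = s - r + D - t /\ y 9%nat = D - r /\ y 10%nat = D - s /\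
  y 11%nat = D /\ y 12%nat = t - s + r /\ y 13%nat = r /\ y 14%nat = s.
Proof using HR r0 rs sD.
  intros.
  assert (y 4%nat = t - D) by step HR 0%nat.
  assert (y 5%nat = s - t) by step HR 1%nat.
  assert (y 6%nat = s - r) by step HR 2%nat.
  assert (y 7%nat = - r) by step HR 3%nat.
  assert (y 8%nat = s - r + D - t) by step HR 4%nat.
  assert (y 9%nat = D - r) by step HR 5%nat.
  assert (y 10%nat = D - s) by step HR 6%nat.
  assert (y 11%nat = D) by step HR 7%nat.
  assert (y 12%nat = t - s + r) by step HR 8%nat.
  assert (y 13%nat = r) by step HR 9%nat.
  assert (y 14%nat = s) by step HR 10%nat.
  tauto.
Qed.

(** The rotation carries the point past the corner [(D, r, r, s)], from the first leg to the
    second. *)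
Lemma orbit_drift_low :
  r <= t -> t <= s -> y 0%nat = D -> y 1%nat = t -> y 2%nat = r -> y 3%nat = s ->
  y 4%nat = s - D /\ y 5%nat = s - t /\ y 6%nat = s - r /\ y 7%nat = - r /\
  y 8%nat = D - r /\ y 9%nat = t - r + D - s /\ y 10%nat = D - s /\
  y 11%nat = D /\ y 12%nat = r /\ y 13%nat = s - t + r /\ y 14%nat = s.
Proof using HR r0 rs sD.
  intros.
  assert (y 4%nat = s - D) by step HR 0%nat.
  assert (y 5%nat = s - t) by step HR 1%nat.
  assert (y 6%nat = s - r) by step HR 2%nat.
  assert (y 7%nat = - r) by step HR 3%nat.
  assert (y 8%nat = D - r) by step HR 4%nat.
  assert (y 9%nat = t - r + D - s) by step HR 5%nat.
  assert (y 10%nat = D - s) by step HR 6%nat.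
  assert (y 11%nat = D) by step HR 7%nat.
  assert (y 12%nat = r) by step HR 8%nat.
  assert (y 13%nat = s - t + r) by step HR 9%nat.
  assert (y 14%nat = s) by step HR 10%nat.
  tauto.
Qed.

(** The rotation carries the point past the corner [(D, r, s, s)], from the second leg to the
    third. *)
Lemma orbit_drift_mid :
  r <= t -> t <= s -> y 0%nat = D -> y 1%nat = r -> y 2%nat = t -> y 3%nat = s ->
  y 4%nat = s - D /\ y 5%nat = s - r /\ y 6%nat = s - t /\ y 7%nat = - r /\
  y 8%nat = D - r /\ y 9%nat = D - s /\ y 10%nat = D - r - s + t /\
  y 11%nat = D /\ y 12%nat = r /\ y 13%nat = s /\ y 14%nat = s - t + r.
Proof using HR r0 rs sD.
  intros.
  assert (y 4%nat = s - D) by step HR 0%nat.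
  assert (y 5%nat = s - r) by step HR 1%nat.
  assert (y 6%nat = s - t) by step HR 2%nat.
  assert (y 7%nat = - r) by step HR 3%nat.
  assert (y 8%nat = D - r) by step HR 4%nat.
  assert (y 9%nat = D - s) by step HR 5%nat.
  assert (y 10%nat = D - r - s + t) by step HR 6%nat.
  assert (y 11%nat = D) by step HR 7%nat.
  assert (y 12%nat = r) by step HR 8%nat.
  assert (y 13%nat = s) by step HR 9%nat.
  assert (y 14%nat = s - t + r) by step HR 10%nat.
  tauto.
Qed.

Lemma orbit_drift_late :
  s - r <= t -> t <= s -> y 0%nat = D -> y 1%nat = r -> y 2%nat = s -> y 3%nat = t ->
  y 4%nat = s - D /\ y 5%nat = s - r /\ y 6%nat = t - s /\ y 7%nat = s - r - t /\
  y 8%nat = D - r /\ y 9%nat = D - s /\ y 10%nat = D - r + s - t /\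
  y 11%nat = D /\ y 12%nat = r /\ y 13%nat = s /\ y 14%nat = t - s + r.
Proof using HR r0 rs sD.
  intros.
  assert (y 4%nat = s - D) by step HR 0%nat.
  assert (y 5%nat = s - r) by step HR 1%nat.
  assert (y 6%nat = t - s) by step HR 2%nat.
  assert (y 7%nat = s - r - t) by step HR 3%nat.
  assert (y 8%nat = D - r) by step HR 4%nat.
  assert (y 9%nat = D - s) by step HR 5%nat.
  assert (y 10%nat = D - r + s - t) by step HR 6%nat.
  assert (y 11%nat = D) by step HR 7%nat.
  assert (y 12%nat = r) by step HR 8%nat.
  assert (y 13%nat = s) by step HR 9%nat.
  assert (y 14%nat = t - s + r) by step HR 10%nat.
  tauto.
Qed.

(** The rotation passes the base point, and the return to the first leg happens already at time
    10. *)
Lemma orbit_wrap :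
  0 <= t -> t <= s - r -> y 0%nat = D -> y 1%nat = r -> y 2%nat = s -> y 3%nat = t ->
  y 4%nat = s - D /\ y 5%nat = s - r /\ y 6%nat = - r /\ y 7%nat = s - r - t /\
  y 8%nat = D - r /\ y 9%nat = D - s /\ y 10%nat = D /\
  y 11%nat = D - s + r + t /\ y 12%nat = r /\ y 13%nat = s.
Proof using HR r0 rs sD.
  intros.
  assert (y 4%nat = s - D) by step HR 0%nat.
  assert (y 5%nat = s - r) by step HR 1%nat.
  assert (y 6%nat = - r) by step HR 2%nat.
  assert (y 7%nat = s - r - t) by step HR 3%nat.
  assert (y 8%nat = D - r) by step HR 4%nat.
  assert (y 9%nat = D - s) by step HR 5%nat.
  assert (y 10%nat = D) by step HR 6%nat.
  assert (y 11%nat = D - s + r + t) by step HR 7%nat.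
  assert (y 12%nat = r) by step HR 8%nat.
  assert (y 13%nat = s) by step HR 9%nat.
  tauto.
Qed.

End Orbits.

(* The state at time [n] is the point at arc length [th] of the curve, measured
   from [(D, D, r, s)]. *)
Definition On (D r s th : R) (y : nat -> R) (n : nat) : Prop :=
  y n = D /\
  y (n + 1)%nat = Rmax r (D - th) /\
  y (n + 2)%nat = Rmax r (Rmin s (th - D + 2 * r)) /\
  y (n + 3)%nat = Rmin s (D + 2 * (s - r) - th).

Lemma On_shift D r s th y n k : On D r s th (shift n y) k <-> On D r s th y (n + k).
Proof. unfold On, shift. now rewrite !Nat.add_assoc. Qed.

(** Along the curve one of the last three coordinates moves at a time, at unit speed, and each of
    them is monotone. Even the two ends [(D, D, r, s)] and [(D, r, s, 0)] have different
    parameters. *)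
Lemma On_inj D r s th th' y n :
  0 <= r -> r <= s -> s <= D ->
  0 <= th <= D + 2 * (s - r) -> 0 <= th' <= D + 2 * (s - r) ->
  On D r s th y n -> On D r s th' y n -> th = th'.
Proof.
  unfold On, Rmax, Rmin; intros.
  repeat destruct (Rle_dec _ _); lra.
Qed.

(** The arc-length formula is traded for the three legs, with conditions that [lra] can use. The
    strict [0 < y 3] on the third leg reflects that [th] stays below the full length. *)
Lemma On_cases D r s th y :
  0 <= r -> r <= s -> s <= D -> 0 <= th < D + 2 * (s - r) -> On D r s th y 0 ->
  y 0%nat = D /\
  ((r <= y 1%nat <= D /\ y 2%nat = r /\ y 3%nat = s /\ th = D - y 1%nat) \/
   (y 1%nat = r /\ r <= y 2%nat <= s /\ y 3%nat = s /\ th = D - 2 * r + y 2%nat) \/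
   (y 1%nat = r /\ y 2%nat = s /\ 0 < y 3%nat <= s /\ th = D + 2 * (s - r) - y 3%nat)).
Proof.
  unfold On, Rmax, Rmin; cbn [Nat.add]; intros.
  repeat destruct (Rle_dec _ _); lra.
Qed.

Lemma cases_On D r s th y n :
  0 <= r -> r <= s -> s <= D -> y n = D ->
  ((r <= y (n + 1)%nat <= D /\ y (n + 2)%nat = r /\ y (n + 3)%nat = s /\
      th = D - y (n + 1)%nat) \/
   (y (n + 1)%nat = r /\ r <= y (n + 2)%nat <= s /\ y (n + 3)%nat = s /\
      th = D - 2 * r + y (n + 2)%nat) \/
   (y (n + 1)%nat = r /\ y (n + 2)%nat = s /\ 0 <= y (n + 3)%nat <= s /\
      th = D + 2 * (s - r) - y (n + 3)%nat)) ->
  On D r s th y n.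
Proof.
  unfold On, Rmax, Rmin; intros.
  repeat destruct (Rle_dec _ _); repeat split; lra.
Qed.

Ltac orbit_cases y D r s th HR HO :=
  let E := fresh "E" in
  destruct (On_cases D r s th y) as (? & E); try assumption; try lra;
  destruct E as [E | [E | E]];
  [ destruct (Rle_dec s (y 1%nat));
    [ destruct (orbit_drift_high y D r s (y 1%nat) HR) as
        (? & ? & ? & ? & ? & ? & ? & ? & ? & ? & ?); try lra
    | destruct (orbit_drift_low y D r s (y 1%nat) HR) as
        (? & ? & ? & ? & ? & ? & ? & ? & ? & ? & ?); try lra ]
  | destruct (orbit_drift_mid y D r s (y 2%nat) HR) as
      (? & ? & ? & ? & ? & ? & ? & ? & ? & ? & ?); try lra
  | destruct (Rle_dec (y 3%nat) (s - r));
    [ destruct (orbit_wrap y D r s (y 3%nat) HR) as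
        (? & ? & ? & ? & ? & ? & ? & ? & ? & ?); try lra
    | destruct (orbit_drift_late y D r s (y 3%nat) HR) as
        (? & ? & ? & ? & ? & ? & ? & ? & ? & ? & ?); try lra ] ].

Lemma On_rotate_0 D r s th y :
  Rec y -> 0 <= r -> r <= s -> s <= D -> 0 <= th < D + 2 * (s - r) ->
  On D r s th y 0 ->
  (th + (s - r) < D + 2 * (s - r) -> On D r s (th + (s - r)) y 11) /\
  (D + 2 * (s - r) <= th + (s - r) ->
     On D r s (th + (s - r) - (D + 2 * (s - r))) y 10).
Proof.
  intros HR r0 rs sD Hth HO.
  split; intros Hw; orbit_cases y D r s th HR HO;
    apply cases_On; cbn [Nat.add]; lra.
Qed.

(** The explicit terms before the next return fit none of the three legs. The strict upper bound on
    [th'] matters: [(D, D, r, s)] is followed by [(D, r, s, 0)], whose parameter is the full length.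
    So does [s - r < D]: three steps lead from [(D, t, 0, D)] to [(D, 0, D - t, D)]. *)
Lemma no_early_return_0 D r s th th' y j :
  Rec y -> 0 <= r -> r < s -> s <= D -> s - r < D ->
  0 <= th < D + 2 * (s - r) -> 0 <= th' < D + 2 * (s - r) ->
  On D r s th y 0 -> (1 <= j <= 10)%nat ->
  (j = 10%nat -> th + (s - r) < D + 2 * (s - r)) ->
  ~ On D r s th' y j.
Proof.
  intros HR r0 rs sD nd Hth Hth' HO Hj H10 HO'.
  assert (HO2 : On D r s th' (shift j y) 0)
    by (apply On_shift; now rewrite Nat.add_0_r).
  destruct (On_cases D r s th' (shift j y)) as (K0 & K); try lra; try assumption.
  clear HO2 HO'. unfold shift in *.
  orbit_cases y D r s th HR HO;
  do 11 (destruct j as [|j];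
    [ cbn [Nat.add] in *; first [lia | try specialize (H10 eq_refl); lra] | ]); lia.
Qed.

Lemma On_rotate D r s th y n :
  Rec y -> 0 <= r -> r <= s -> s <= D -> 0 <= th < D + 2 * (s - r) ->
  On D r s th y n ->
  (th + (s - r) < D + 2 * (s - r) -> On D r s (th + (s - r)) y (n + 11)) /\
  (D + 2 * (s - r) <= th + (s - r) ->
     On D r s (th + (s - r) - (D + 2 * (s - r))) y (n + 10)).
Proof.
  intros HR r0 rs sD Hth HO. rewrite <- !On_shift.
  apply On_rotate_0; try assumption; try now apply Rec_shift.
  apply On_shift. now rewrite Nat.add_0_r.
Qed.

Lemma no_early_return D r s th th' y n j :
  Rec y -> 0 <= r -> r < s -> s <= D -> s - r < D ->
  0 <= th < D + 2 * (s - r) -> 0 <= th' < D + 2 * (s - r) ->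
  On D r s th y n -> (1 <= j <= 10)%nat ->
  (j = 10%nat -> th + (s - r) < D + 2 * (s - r)) ->
  ~ On D r s th' y (n + j).
Proof.
  intros. rewrite <- On_shift.
  apply no_early_return_0 with th; try assumption; try now apply Rec_shift.
  apply On_shift. now rewrite Nat.add_0_r.
Qed.

(* After [k] returns, [w] of them through the base point, the time is
   [11 k - w]. *)
Definition angle (D r s th : R) (k w : nat) : R :=
  th + INR k * (s - r) - INR w * (D + 2 * (s - r)).

Lemma return_times D r s th y :
  Rec y -> 0 <= r -> r < s -> s <= D -> 0 <= th < D + 2 * (s - r) ->
  On D r s th y 0 ->
  forall k, exists w, (w <= k)%nat /\
    0 <= angle D r s th k w < D + 2 * (s - r) /\
    On D r s (angle D r s th k w) y (11 * k - w).
Proof.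
  intros HR r0 rs sD Hth HO k. unfold angle.
  induction k as [|k (w & Hw & Ha & Hk)].
  - exists 0%nat. cbn [INR].
    replace (th + 0 * (s - r) - 0 * (D + 2 * (s - r))) with th by ring.
    split; [lia | split; [lra | exact HO]].
  - destruct (On_rotate _ _ _ _ _ _ HR r0 (Rlt_le _ _ rs) sD Ha Hk) as [H11 H10].
    destruct (Rlt_le_dec (angle D r s th k w + (s - r)) (D + 2 * (s - r))) as [L | L];
      unfold angle in L.
    + exists w. specialize (H11 L).
      replace (th + INR (S k) * (s - r) - INR w * (D + 2 * (s - r)))
        with (th + INR k * (s - r) - INR w * (D + 2 * (s - r)) + (s - r))
        by (rewrite S_INR; ring).
      replace (11 * S k - w)%nat with (11 * k - w + 11)%nat by lia.
      split; [lia | split; [lra | assumption]].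
    + exists (S w). specialize (H10 L).
      replace (th + INR (S k) * (s - r) - INR (S w) * (D + 2 * (s - r)))
        with (th + INR k * (s - r) - INR w * (D + 2 * (s - r)) + (s - r)
                - (D + 2 * (s - r)))
        by (rewrite !S_INR; ring).
      replace (11 * S k - S w)%nat with (11 * k - w + 10)%nat by lia.
      split; [lia | split; [lra | assumption]].
Qed.

(** Here [n] is the time of the last completed rotation and [j] counts the steps since then. The
    positive values of [j] left possible are exactly those that [no_early_return] handles. *)
Lemma time_since_return D r s th y :
  Rec y -> 0 <= r -> r < s -> s <= D -> 0 <= th < D + 2 * (s - r) ->
  On D r s th y 0 ->
  forall m, exists k w n j, (m = n + j /\ n + w = 11 * k /\ j <= 10)%nat /\
    0 <= angle D r s th k w < D + 2 * (s - r) /\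
    On D r s (angle D r s th k w) y n /\
    (j = 10%nat -> angle D r s th k w + (s - r) < D + 2 * (s - r)).
Proof.
  intros HR r0 rs sD Hth HO m.
  induction m as [|m (k & w & n & j & (Em & En & Hj) & Ha & Hn & H10)].
  - exists 0%nat, 0%nat, 0%nat, 0%nat. unfold angle. cbn [INR].
    replace (th + 0 * (s - r) - 0 * (D + 2 * (s - r))) with th by ring.
    repeat split; try lia; try lra; try assumption; apply HO.
  - destruct (On_rotate _ _ _ _ _ _ HR r0 (Rlt_le _ _ rs) sD Ha Hn) as [R11 R10].
    destruct (Rlt_le_dec (angle D r s th k w + (s - r)) (D + 2 * (s - r))) as [L | L].
    (* Without passing the base point the counter [j] restarts after 11 steps, otherwise after
       10. *)
    + destruct (Nat.eq_dec j 10) as [-> | Nj].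
      * specialize (R11 L). exists (S k), w, (n + 11)%nat, 0%nat.
        assert (E : angle D r s th (S k) w = angle D r s th k w + (s - r))
          by (unfold angle; rewrite S_INR; ring).
        rewrite E. repeat split; try lia; try lra; apply R11.
      * exists k, w, n, (S j). repeat split; try lia; try lra; apply Hn.
    + destruct (Nat.eq_dec j 10) as [-> | N10]; [specialize (H10 eq_refl); lra |].
      destruct (Nat.eq_dec j 9) as [-> | N9].
      * specialize (R10 L). exists (S k), (S w), (n + 10)%nat, 0%nat.
        assert (E : angle D r s th (S k) (S w)
                    = angle D r s th k w + (s - r) - (D + 2 * (s - r)))
          by (unfold angle; rewrite !S_INR; ring).
        rewrite E. repeat split; try lia; try lra; apply R10.
      * exists k, w, n, (S j). repeat split; try lia; try lra; apply Hn.
Qed.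

(** * Periods *)

Lemma Rec_unique y z : Rec y -> Rec z ->
  y 0%nat = z 0%nat -> y 1%nat = z 1%nat -> y 2%nat = z 2%nat -> y 3%nat = z 3%nat ->
  forall i, y i = z i.
Proof.
  intros Hy Hz E0 E1 E2 E3.
  assert (H : forall i, y i = z i /\ y (i + 1)%nat = z (i + 1)%nat /\
                        y (i + 2)%nat = z (i + 2)%nat /\ y (i + 3)%nat = z (i + 3)%nat).
  { induction i as [|i (F0 & F1 & F2 & F3)]; [now cbn [Nat.add] |].
    replace (S i + 1)%nat with (i + 2)%nat by lia.
    replace (S i + 2)%nat with (i + 3)%nat by lia.
    replace (S i + 3)%nat with (i + 4)%nat by lia.
    replace (S i) with (i + 1)%nat by lia.
    repeat split; try assumption.
    rewrite (Hy i), (Hz i). congruence. }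
  apply H.
Qed.

Lemma rep_of_state y m : Rec y -> (1 <= m)%nat ->
  y m = y 0%nat -> y (m + 1)%nat = y 1%nat -> y (m + 2)%nat = y 2%nat ->
  y (m + 3)%nat = y 3%nat -> rep y m.
Proof.
  intros HR Hm E0 E1 E2 E3. split; [assumption |]. intros i.
  rewrite Nat.add_comm.
  apply (Rec_unique (shift m y) y); try assumption; try now apply Rec_shift.
  unfold shift. now rewrite Nat.add_0_r.
Qed.

Lemma rep_mult y m c i : rep y m -> y (i + c * m)%nat = y i.
Proof.
  intros [_ H]. induction c as [|c IH]; [now rewrite Nat.add_0_r |].
  replace (i + S c * m)%nat with (i + c * m + m)%nat by lia.
  now rewrite H.
Qed.

Lemma rep_shift n y m k : rep y m -> (rep (shift n y) k <-> rep y k).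
Proof.
  intros Hm. split; intros [Hk H]; split; try assumption; intros i; unfold shift in *.
  (* Moving the index forward by [n] periods allows the shift by [n] to be undone; the subtraction
     below is exact because [1 <= m]. *)
  - rewrite <- (rep_mult y m n (i + k) Hm), <- (rep_mult y m n i Hm).
    assert (1 <= m)%nat by apply Hm.
    specialize (H (i + n * m - n)%nat).
    replace (n + (i + n * m - n + k))%nat with (i + k + n * m)%nat in H by nia.
    replace (n + (i + n * m - n))%nat with (i + n * m)%nat in H by nia.
    exact H.
  - now rewrite Nat.add_assoc.
Qed.

Definition minrep (y : nat -> R) (m : nat) : Prop :=
  rep y m /\ forall k, rep y k -> (m <= k)%nat.

(** A nonzero remainder [k mod m] would be a repetition length smaller than [m]. *)
Lemma minrep_divide y m k : minrep y m -> rep y k -> Nat.divide m k.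
Proof.
  intros [Hm Hmin] Hk.
  assert (1 <= m)%nat by apply Hm.
  destruct (Nat.eq_dec (k mod m) 0) as [E | N].
  - now apply Nat.Lcm0.mod_divide.
  - assert (k mod m < m)%nat by (apply Nat.mod_upper_bound; lia).
    assert (m <= k mod m)%nat; [| lia].
    apply Hmin. split; [lia |]. intros i.
    rewrite <- (rep_mult y m (k / m) (i + k mod m) Hm).
    replace (i + k mod m + k / m * m)%nat with (i + k)%nat.
    + apply Hk.
    + rewrite (Nat.div_mod_eq k m) at 1. lia.
Qed.

(** At time [m] the state is again the point [th]. Since early returns are excluded, [m] completes a
    rotation, and [On_inj] equates the angle reached with [th]. *)
Lemma rep_angle D r s th y :
  Rec y -> 0 <= r -> r < s -> s <= D -> s - r < D -> 0 <= th < D + 2 * (s - r) ->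
  On D r s th y 0 ->
  forall m, rep y m ->
  exists k w, (m + w = 11 * k)%nat /\
    INR k * (s - r) = INR w * (D + 2 * (s - r)).
Proof.
  intros HR r0 rs sD nd Hth HO m Hm.
  destruct (time_since_return D r s th y HR r0 rs sD Hth HO m)
    as (k & w & n & j & (Em & En & Hj) & Ha & Hn & H10).
  assert (Hret : On D r s th y m).
  { destruct Hm as [_ Hm]. unfold On in *.
    rewrite !(Nat.add_comm m), !Hm. pose proof (Hm 0%nat) as E. cbn [Nat.add] in E.
    rewrite E. exact HO. }
  destruct (Nat.eq_dec j 0) as [-> | Nj].
  - rewrite Nat.add_0_r in Em. subst n. exists k, w. split; [assumption |].
    assert (E := On_inj D r s _ _ y m r0 (Rlt_le _ _ rs) sD
                   (conj (proj1 Ha) (Rlt_le _ _ (proj2 Ha)))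
                   (conj (proj1 Hth) (Rlt_le _ _ (proj2 Hth))) Hn Hret).
    unfold angle in E. lra.
  - rewrite Em in Hret. exfalso. revert Hret.
    apply no_early_return with (angle D r s th k w); try assumption; lia.
Qed.

Lemma angle_rep D r s th y :
  Rec y -> 0 <= r -> r < s -> s <= D -> 0 <= th < D + 2 * (s - r) ->
  On D r s th y 0 ->
  forall k w, (1 <= k)%nat -> INR k * (s - r) = INR w * (D + 2 * (s - r)) ->
  (w <= k)%nat /\ rep y (11 * k - w).
Proof.
  intros HR r0 rs sD Hth HO k w Hk E.
  destruct (return_times D r s th y HR r0 rs sD Hth HO k) as (w' & Hw' & Ha & Hn).
  (* Subtracting [w] turns gives the angle [th], and only one number of turns brings the angle into
     the half-open range. *)
  assert (w' = w).
  { unfold angle in Ha. rewrite E in Ha.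
    destruct (Nat.lt_trichotomy w' w) as [L | [L | L]]; [| assumption |];
      apply (le_INR (S _)) in L; rewrite S_INR in L; nra. }
  subst w'. split; [assumption |].
  assert (Ea : angle D r s th k w = th) by (unfold angle; lra).
  rewrite Ea in Hn.
  destruct Hn as (A0 & A1 & A2 & A3), HO as (B0 & B1 & B2 & B3).
  cbn [Nat.add] in *.
  apply rep_of_state; try assumption; try lia; congruence.
Qed.

Lemma minrep_curve D r s th y m :
  Rec y -> 0 <= r -> r < s -> s <= D -> s - r < D -> 0 <= th < D + 2 * (s - r) ->
  On D r s th y 0 -> minrep y m ->
  exists a b : nat, (1 <= a /\ 1 <= b /\ Nat.gcd a b = 1 /\ 2 * a + 1 <= b /\
                     m = 10 * a + 11 * b)%nat.
Proof.
  intros HR r0 rs sD nd Hth HO [Hm Hmin].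
  destruct (rep_angle D r s th y HR r0 rs sD nd Hth HO m Hm) as (k & w & Et & E).
  assert (1 <= m)%nat by apply Hm.
  assert (1 <= k)%nat by lia.
  assert (Hk : 1 <= INR k) by (apply (le_INR 1); lia).
  assert (Hw : (1 <= w)%nat).
  { destruct w; [cbn [INR] in E; nra | lia]. }
  (* Since [s - r < D], the length of the curve exceeds [3 * (s - r)]. *)
  assert (H3 : (3 * w < k)%nat).
  { apply INR_lt. rewrite mult_INR. cbn [INR].
    apply (le_INR 1) in Hw. cbn [INR] in Hw. nra. }
  destruct (Nat.gcd_divide_l k w) as [k' Ek], (Nat.gcd_divide_r k w) as [w' Ew].
  set (g := Nat.gcd k w) in *.
  (* The equation survives division by [g], so [m / g] is also a repetition length, and minimality
     of [m] forces [g = 1]. *)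
  assert (g = 1%nat).
  { destruct (angle_rep D r s th y HR r0 rs sD Hth HO k' w') as [L Hrep].
    - nia.
    - rewrite Ek, Ew, !mult_INR in E.
      assert (0 < INR g) by (apply lt_0_INR; nia). nra.
    - apply Hmin in Hrep. nia. }
  exists w, (k - w)%nat. repeat split; try lia.
  rewrite Nat.gcd_sub_diag_r by lia. rewrite Nat.gcd_comm. assumption.
Qed.

Lemma rep_11_of_decreasing y :
  Rec y -> y 1%nat <= y 0%nat -> y 2%nat <= y 1%nat -> y 3%nat <= y 2%nat ->
  0 <= y 3%nat -> rep y 11.
Proof.
  intros HR.
  intros.
  assert (y 4%nat = y 1%nat - y 0%nat) by step HR 0%nat.
  assert (y 5%nat = y 2%nat - y 1%nat) by step HR 1%nat.
  assert (y 6%nat = y 3%nat - y 2%nat) by step HR 2%nat.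
  assert (y 7%nat = - y 3%nat) by step HR 3%nat.
  assert (y 8%nat = y 0%nat - y 1%nat) by step HR 4%nat.
  assert (y 9%nat = y 0%nat - y 2%nat) by step HR 5%nat.
  assert (y 10%nat = y 0%nat - y 3%nat) by step HR 6%nat.
  assert (y 11%nat = y 0%nat) by step HR 7%nat.
  assert (y 12%nat = y 1%nat) by step HR 8%nat.
  assert (y 13%nat = y 2%nat) by step HR 9%nat.
  assert (y 14%nat = y 3%nat) by step HR 10%nat.
  apply rep_of_state; try assumption; lia.
Qed.

(** This is the degenerate curve [(r, s) = (0, D)]. The value of [y 4] is recorded so that
    [minrep_8] can exclude smaller periods when [D] is nonzero. *)
Lemma orbit_8 D t y :
  Rec y -> 0 <= t <= D -> y 0%nat = D -> y 1%nat = t -> y 2%nat = 0 -> y 3%nat = D ->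
  y 4%nat = 0 /\ rep y 8.
Proof.
  intros HR. intros.
  assert (y 4%nat = 0) by step HR 0%nat.
  assert (y 5%nat = D - t) by step HR 1%nat.
  assert (y 6%nat = D) by step HR 2%nat.
  assert (y 7%nat = 0) by step HR 3%nat.
  assert (y 8%nat = D) by step HR 4%nat.
  assert (y 9%nat = t) by step HR 5%nat.
  assert (y 10%nat = 0) by step HR 6%nat.
  assert (y 11%nat = D) by step HR 7%nat.
  split; [assumption |].
  apply rep_of_state; try assumption; cbn [Nat.add]; lra || lia.
Qed.

(** * Reaching a section state *)

Definition peak (y : nat -> R) (n : nat) : Prop :=
  0 <= y (n + 1)%nat <= y n /\ 0 <= y (n + 2)%nat <= y n /\
  0 <= y (n + 3)%nat <= y n.

Lemma peak_shift n k y : peak (shift n y) k <-> peak y (n + k).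
Proof. unfold peak, shift. now rewrite !Nat.add_assoc. Qed.

Definition reaches (y : nat -> R) : Prop := exists n, peak y n.

Lemma reaches_shift n y : reaches (shift n y) -> reaches y.
Proof. intros [k H]. apply peak_shift in H. now exists (n + k)%nat. Qed.

(** The peak is at the largest of the four terms: while that term is among the three compared, each
    new term is its difference with an earlier one, hence lies between 0 and it. *)
Lemma reaches_of_nonneg y : Rec y ->
  0 <= y 0%nat -> 0 <= y 1%nat -> 0 <= y 2%nat -> 0 <= y 3%nat -> reaches y.
Proof.
  intros HR H0 H1 H2 H3.
  destruct (Rec_sum_max y 0 HR) as (? & ? & ? & ? & B0).
  destruct (Rec_sum_max y 1 HR) as (? & ? & ? & ? & B1).
  destruct (Rec_sum_max y 2 HR) as (? & ? & ? & ? & B2).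
  cbn [Nat.add] in *.
  destruct (Rle_dec (y 0%nat) (y 3%nat)), (Rle_dec (y 1%nat) (y 3%nat)),
    (Rle_dec (y 2%nat) (y 3%nat)), (Rle_dec (y 0%nat) (y 2%nat)),
    (Rle_dec (y 1%nat) (y 2%nat)), (Rle_dec (y 0%nat) (y 1%nat)); try lra;
  first [ exists 0%nat; unfold peak; cbn [Nat.add]; lra
        | exists 1%nat; unfold peak; cbn [Nat.add]; lra
        | exists 2%nat; unfold peak; cbn [Nat.add]; lra
        | exists 3%nat; unfold peak; cbn [Nat.add]; lra ].
Qed.

Ltac nonneg_from y n :=
  apply (reaches_shift n), reaches_of_nonneg;
    [now apply Rec_shift | unfold shift; cbn [Nat.add]; lra ..].

(** Terms four apart have a nonnegative sum, so nonpositive terms produce nonnegative ones four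
    steps later. The signs of [y 0] and [y 3] and their order decide where four nonnegative terms
    begin. *)
Lemma reaches_of_two_nonpos y : Rec y ->
  y 1%nat <= 0 -> y 2%nat <= 0 -> reaches y.
Proof.
  intros HR H1 H2.
  assert (all_neg : forall z, Rec z -> z 0%nat <= 0 -> z 1%nat <= 0 ->
            z 2%nat <= 0 -> z 3%nat <= 0 -> reaches z).
  { intros z Hz. intros.
    assert (z 4%nat = - z 0%nat) by step Hz 0%nat.
    assert (z 5%nat = z 4%nat - z 1%nat) by step Hz 1%nat.
    assert (z 6%nat = z 5%nat - z 2%nat) by step Hz 2%nat.
    assert (z 7%nat = z 6%nat - z 3%nat) by step Hz 3%nat.
    nonneg_from z 4%nat. }
  destruct (Rle_dec (y 3%nat) 0).
  - destruct (Rle_dec (y 0%nat) 0); [now apply all_neg |].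
    assert (y 4%nat = - y 0%nat) by step HR 0%nat.
    apply (reaches_shift 1), all_neg;
      [now apply Rec_shift | unfold shift; cbn [Nat.add]; lra ..].
  - assert (y 4%nat = y 3%nat - y 0%nat) by step HR 0%nat.
    destruct (Rec_sum_max y 1 HR) as (? & ? & ? & ? & _).
    destruct (Rec_sum_max y 2 HR) as (? & ? & ? & ? & _).
    destruct (Rec_sum_max y 3 HR) as (? & ? & ? & ? & _).
    destruct (Rec_sum_max y 4 HR) as (? & ? & ? & ? & _).
    destruct (Rec_sum_max y 5 HR) as (? & ? & ? & ? & _).
    cbn [Nat.add] in *.
    destruct (Rle_dec (y 0%nat) (y 3%nat)).
    + nonneg_from y 3%nat.
    + nonneg_from y 5%nat.
Qed.

(** Now [y 4] is positive. The signs of [y 1], [y 2], [y 3] lead either to two adjacent nonpositive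
    terms or to four consecutive nonnegative ones. *)
Lemma reaches_of_neg y : Rec y -> y 0%nat < 0 -> reaches y.
Proof.
  intros HR H0.
  destruct (Rle_dec (y 1%nat) 0).
  { destruct (Rle_dec (y 2%nat) 0); [now apply reaches_of_two_nonpos |].
    destruct (Rec_sum_max y 0 HR) as (? & ? & ? & ? & _).
    destruct (Rec_sum_max y 1 HR) as (? & ? & ? & ? & _).
    destruct (Rec_sum_max y 2 HR) as (? & ? & ? & ? & _).
    destruct (Rec_sum_max y 3 HR) as (? & ? & ? & ? & _).
    destruct (Rec_sum_max y 4 HR) as (? & ? & ? & ? & _).
    cbn [Nat.add] in *.
    destruct (Rle_dec 0 (y 3%nat)).
    - nonneg_from y 2%nat.
    - nonneg_from y 4%nat. }
  destruct (Rec_sum_max y 0 HR) as (? & ? & ? & ? & _).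
  destruct (Rec_sum_max y 1 HR) as (? & ? & ? & ? & _).
  destruct (Rec_sum_max y 2 HR) as (? & ? & ? & ? & _).
  destruct (Rec_sum_max y 3 HR) as (? & ? & ? & ? & _).
  cbn [Nat.add] in *.
  destruct (Rle_dec (y 2%nat) 0), (Rle_dec (y 3%nat) 0).
  - apply (reaches_shift 1), reaches_of_two_nonpos; [now apply Rec_shift | assumption ..].
  - nonneg_from y 3%nat.
  - nonneg_from y 4%nat.
  - nonneg_from y 1%nat.
Qed.

Lemma reaches_peak y : Rec y -> reaches y.
Proof.
  intros HR.
  destruct (Rlt_le_dec (y 0%nat) 0); [now apply reaches_of_neg |].
  destruct (Rlt_le_dec (y 1%nat) 0);
    [apply (reaches_shift 1), reaches_of_neg; [now apply Rec_shift | assumption] |].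
  destruct (Rlt_le_dec (y 2%nat) 0);
    [apply (reaches_shift 2), reaches_of_neg; [now apply Rec_shift | assumption] |].
  destruct (Rlt_le_dec (y 3%nat) 0);
    [apply (reaches_shift 3), reaches_of_neg; [now apply Rec_shift | assumption] |].
  now apply reaches_of_nonneg.
Qed.


(** If [y 1], [y 2], [y 3] do not decrease, some ascent among them supplies [r < s], and their order
    tells which leg of the curve the state is on. *)
Lemma peak_curve y : Rec y -> peak y 0 ->
  (y 2%nat <= y 1%nat /\ y 3%nat <= y 2%nat) \/
  exists n D r s th, 0 <= r /\ r < s /\ s <= D /\ 0 <= th < D + 2 * (s - r) /\
    On D r s th y n.
Proof.
  intros HR HP. unfold peak in HP. cbn [Nat.add] in HP.
  destruct (Rle_dec (y 2%nat) (y 1%nat)).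
  - destruct (Rle_dec (y 3%nat) (y 2%nat)); [now left | right].
    exists 0%nat, (y 0%nat), (y 2%nat), (y 3%nat), (y 0%nat - y 1%nat).
    do 4 (split; [lra |]). apply cases_On; cbn [Nat.add]; lra.
  - right. destruct (Rle_dec (y 2%nat) (y 3%nat)).
    + exists 0%nat, (y 0%nat), (y 1%nat), (y 3%nat), (y 0%nat - 2 * y 1%nat + y 2%nat).
      do 4 (split; [lra |]). apply cases_On; cbn [Nat.add]; lra.
    + destruct (Rle_dec (y 3%nat) 0).
      * (* [(D, r, s, 0)] comes one step after the base point of the curve. *)
        destruct (orbit_wrap y (y 0%nat) (y 1%nat) (y 2%nat) (y 3%nat) HR) as
          (? & ? & ? & ? & ? & ? & ? & ? & ? & ?); try lra.
        exists 10%nat, (y 0%nat), (y 1%nat), (y 2%nat), (y 2%nat - y 1%nat).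
        do 4 (split; [lra |]). apply cases_On; cbn [Nat.add]; lra.
      * exists 0%nat, (y 0%nat), (y 1%nat), (y 2%nat),
          (y 0%nat + 2 * (y 2%nat - y 1%nat) - y 3%nat).
        do 4 (split; [lra |]). apply cases_On; cbn [Nat.add]; lra.
Qed.

Lemma reaches_curve y : Rec y ->
  exists n, rep (shift n y) 11 \/
  exists D r s th, 0 <= r /\ r < s /\ s <= D /\ 0 <= th < D + 2 * (s - r) /\
    On D r s th (shift n y) 0.
Proof.
  intros HR. destruct (reaches_peak y HR) as [n HP].
  rewrite <- (Nat.add_0_r n), <- peak_shift in HP.
  pose proof (Rec_shift n y HR) as HRn.
  destruct (peak_curve _ HRn HP) as [[? ?] | (k & D & r & s & th & ? & ? & ? & ? & HO)].
  - exists n. left. unfold peak in HP. cbn [Nat.add] in HP.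
    apply rep_11_of_decreasing; try assumption; lra.
  - exists (n + k)%nat. right. exists D, r, s, th. repeat (split; [assumption |]).
    apply On_shift in HO. apply On_shift. now rewrite Nat.add_0_r.
Qed.

(** * The possible periods *)

Lemma minrep_11 y m : minrep y m -> rep y 11 -> m = 1%nat \/ m = 11%nat.
Proof.
  intros Hm H11. destruct (minrep_divide y m 11 Hm H11) as [c Hc].
  assert (Hl : (m <= 11)%nat) by now apply Hm.
  do 12 (destruct m as [|m]; [lia |]). lia.
Qed.

(** Every proper divisor of 8 divides 4. *)
Lemma minrep_8 y m : minrep y m -> rep y 8 -> y 4%nat <> y 0%nat -> m = 8%nat.
Proof.
  intros Hm H8 N. destruct (minrep_divide y m 8 Hm H8) as [c Hc].
  assert (Hl : (m <= 8)%nat) by now apply Hm.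
  destruct Hm as [Hm _].
  destruct (Nat.eq_dec m 8) as [| N8]; [assumption |]. exfalso. apply N.
  assert (Hd : exists d, (d * m = 4)%nat).
  { do 9 (destruct m as [|m]; [first [lia | now exists 4%nat | now exists 2%nat
                                     | now exists 1%nat] |]). lia. }
  destruct Hd as [d Hd]. rewrite <- (rep_mult y m d 0 Hm). now rewrite Hd.
Qed.

Lemma minrep_values y m : Rec y -> minrep y m ->
  (m = 1 \/ m = 8 \/ m = 11 \/
   exists a b : nat,
     1 <= a /\ 1 <= b /\ Nat.gcd a b = 1 /\ 2 * a + 1 <= b /\
     m = 10 * a + 11 * b)%nat.
Proof.
  intros HR Hm. destruct (reaches_curve y HR) as [n Hn].
  pose proof (Rec_shift n y HR) as HRn.
  assert (Hmn : minrep (shift n y) m).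
  { destruct Hm as [Hm Hmin]. split; [now apply (rep_shift n y m m Hm) |].
    intros k Hk. apply Hmin. now apply (rep_shift n y m k Hm). }
  destruct Hn as [H11 | (D & r & s & th & r0 & rs & sD & Hth & HO)].
  - destruct (minrep_11 _ m Hmn H11); tauto.
  - destruct (Rlt_le_dec (s - r) D) as [nd | deg].
    + do 3 right. now apply minrep_curve with D r s th (shift n y).
    + right; left.
      assert (r = 0) by lra. assert (s = D) by lra. subst r s.
      (* Some state of the orbit has the form [(D, t, 0, D)]. *)
      assert (Hk : exists k th', 0 <= th' <= D /\ On D 0 D th' (shift n y) k).
      { destruct (Rle_dec th D); [exists 0%nat, th; split; [lra | assumption] |].
        (* The rotation is by [D] on a circle of length [3 * D], so one or two returns lead from
           [th > D] into [[0, D]]. *)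
        destruct (return_times D 0 D th _ HRn r0 rs sD Hth HO 1)
          as (w1 & ? & ? & H1).
        destruct (return_times D 0 D th _ HRn r0 rs sD Hth HO 2)
          as (w2 & ? & ? & H2).
        unfold angle in *. cbn [INR] in *.
        destruct w1 as [|[|]]; [| | lia]; cbn [INR] in *.
        - destruct w2 as [|[|[|]]]; [| | | lia]; cbn [INR] in *; [lra | | lra].
          eexists _, _. split; [| exact H2]. lra.
        - eexists _, _. split; [| exact H1]. lra. }
      destruct Hk as (k & th' & Hth' & HOk).
      rewrite <- (Nat.add_0_r k), <- On_shift in HOk.
      assert (Hmk : minrep (shift k (shift n y)) m).
      { destruct Hmn as [Hm1 Hmin]. split; [now apply (rep_shift k _ m m Hm1) |].
        intros l Hl. apply Hmin. now apply (rep_shift k _ m l Hm1). }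
      pose proof (Rec_shift k _ HRn) as HRk.
      destruct (On_cases D 0 D th' (shift k (shift n y)) r0 (Rlt_le _ _ rs) sD) as (E0 & E);
        [lra | exact HOk |].
      destruct (orbit_8 D (shift k (shift n y) 1%nat) _ HRk) as [E4 H8]; try lra.
      apply minrep_8 with (shift k (shift n y)); try assumption. lra.
Qed.

(** * Realizing the periods *)

Definition state : Type := (R * R * R * R)%type.

Definition next (v : state) : state :=
  let '(a, b, c, d) := v in (b, c, d, Rmax (Rmax (Rmax d c) b) 0 - a).

Definition sol (v : state) (i : nat) : R := fst (fst (fst (Nat.iter i next v))).

Lemma sol_window v i :
  Nat.iter i next v =
    (sol v i, sol v (i + 1)%nat, sol v (i + 2)%nat, sol v (i + 3)%nat).
Proof.
  rewrite !(Nat.add_comm i). unfold sol.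
  change (Nat.iter (1 + i) next v) with (next (Nat.iter i next v)).
  change (Nat.iter (2 + i) next v) with (next (next (Nat.iter i next v))).
  change (Nat.iter (3 + i) next v) with (next (next (next (Nat.iter i next v)))).
  now destruct (Nat.iter i next v) as [[[a b] c] d].
Qed.

Lemma sol_Rec v : Rec (sol v).
Proof.
  intros i. pose proof (sol_window v i) as E.
  replace (sol v (i + 4)%nat) with (snd (Nat.iter (S i) next v)).
  - change (Nat.iter (S i) next v) with (next (Nat.iter i next v)). now rewrite E.
  - rewrite sol_window. cbn [snd]. f_equal. lia.
Qed.

Lemma minrep_sol_1 : minrep (sol (0, 0, 0, 0)) 1.
Proof.
  pose proof (sol_Rec (0, 0, 0, 0)) as HR.
  split; [| now intros k [Hk _]].
  assert (sol (0, 0, 0, 0) 0%nat = 0) by reflexivity.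
  assert (sol (0, 0, 0, 0) 1%nat = 0) by reflexivity.
  assert (sol (0, 0, 0, 0) 2%nat = 0) by reflexivity.
  assert (sol (0, 0, 0, 0) 3%nat = 0) by reflexivity.
  assert (sol (0, 0, 0, 0) 4%nat = 0) by step HR 0%nat.
  apply rep_of_state; try assumption; try lia; cbn [Nat.add]; lra.
Qed.

Lemma minrep_sol_8 : minrep (sol (1, 0, 0, 1)) 8.
Proof.
  pose proof (sol_Rec (1, 0, 0, 1)) as HR.
  set (y := sol (1, 0, 0, 1)) in *.
  assert (y 0%nat = 1) by reflexivity.
  assert (y 1%nat = 0) by reflexivity.
  assert (y 2%nat = 0) by reflexivity.
  assert (y 3%nat = 1) by reflexivity.
  destruct (orbit_8 1 0 y HR) as [_ H8]; try lra.
  split; [assumption |]. intros k [Hk Hp].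
  assert (y 4%nat = 0) by step HR 0%nat.
  assert (y 5%nat = 1) by step HR 1%nat.
  assert (y 6%nat = 1) by step HR 2%nat.
  assert (y 7%nat = 0) by step HR 3%nat.
  assert (y 8%nat = 1) by step HR 4%nat.
  assert (y 9%nat = 0) by step HR 5%nat.
  pose proof (Hp 0%nat). pose proof (Hp 1%nat). pose proof (Hp 2%nat).
  do 8 (destruct k as [|k]; [first [lia | cbn [Nat.add] in *; lra] |]). lia.
Qed.

Lemma minrep_sol_11 : minrep (sol (1, 0, 0, 0)) 11.
Proof.
  pose proof (sol_Rec (1, 0, 0, 0)) as HR.
  set (y := sol (1, 0, 0, 0)) in *.
  assert (y 0%nat = 1) by reflexivity.
  assert (y 1%nat = 0) by reflexivity.
  assert (y 2%nat = 0) by reflexivity.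
  assert (y 3%nat = 0) by reflexivity.
  assert (H11 : rep y 11) by (apply rep_11_of_decreasing; try assumption; lra).
  split; [assumption |]. intros k [Hk Hp].
  pose proof (proj2 H11) as P.
  pose proof (P 0%nat). pose proof (P 1%nat). pose proof (P 2%nat). pose proof (P 3%nat).
  assert (y 4%nat = -1) by step HR 0%nat.
  assert (y 5%nat = 0) by step HR 1%nat.
  assert (y 6%nat = 0) by step HR 2%nat.
  assert (y 7%nat = 0) by step HR 3%nat.
  assert (y 8%nat = 1) by step HR 4%nat.
  assert (y 9%nat = 1) by step HR 5%nat.
  assert (y 10%nat = 1) by step HR 6%nat.
  (* The value -1 occurs only once among eleven consecutive terms, at index 4. *)
  pose proof (Hp 4%nat).
  do 11 (destruct k as [|k]; [first [lia | cbn [Nat.add] in *; lra] |]). lia.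
Qed.

(** With [D = b - a], [r = 0], [s = a] the curve has length [a + b] and the rotation is by [a]. The
    orbit starts at the base point. *)
Lemma minrep_sol_curve a b :
  (1 <= a)%nat -> Nat.gcd a b = 1%nat -> (2 * a + 1 <= b)%nat ->
  minrep (sol (INR b - INR a, INR b - INR a, 0, INR a)) (10 * a + 11 * b).
Proof.
  intros Ha Hg Hb.
  set (y := sol (INR b - INR a, INR b - INR a, 0, INR a)).
  assert (HR : Rec y) by apply sol_Rec.
  assert (Pa : 1 <= INR a) by (apply (le_INR 1); lia).
  assert (Pb : 2 * INR a + 1 <= INR b).
  { apply le_INR in Hb. rewrite plus_INR, mult_INR in Hb. cbn [INR] in Hb. lra. }
  assert (HO : On (INR b - INR a) 0 (INR a) 0 y 0).
  { apply cases_On; try lra; [reflexivity |].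
    left. cbn [Nat.add].
    assert (y 1%nat = INR b - INR a) by reflexivity.
    assert (y 2%nat = 0) by reflexivity.
    assert (y 3%nat = INR a) by reflexivity. lra. }
  split.
  - replace (10 * a + 11 * b)%nat with (11 * (a + b) - a)%nat by lia.
    refine (proj2 (angle_rep _ _ _ _ y HR _ _ _ _ HO (a + b) a _ _)); try lra; try lia.
    rewrite plus_INR. ring.
  - intros m Hm.
    destruct (rep_angle (INR b - INR a) 0 (INR a) 0 y HR) with (m := m)
      as (k & w & Et & E); try lra; try assumption.
    assert (E' : (k * a = w * (a + b))%nat).
    { apply INR_eq. rewrite !mult_INR, plus_INR.
      transitivity (INR k * (INR a - 0)); [ring |]. rewrite E. ring. }
    assert (1 <= m)%nat by apply Hm.
    (* As [a + b] is coprime to [a], the least solution is [k = a + b], [w = a]. *)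
    assert (Hd : Nat.divide (a + b) k).
    { apply Nat.gauss with a; [exists w; lia |].
      rewrite Nat.gcd_comm, Nat.add_comm, Nat.gcd_add_diag_r. assumption. }
    destruct Hd as [c ->].
    assert (w = c * a)%nat by nia.
    destruct c; nia.
Qed.

(** * Back to the indexing from 1 *)

Lemma Per_F4_iff p : Per_F4 p <-> exists y, Rec y /\ minrep y p.
Proof.
  split.
  - intros (x & Hx & Hp & Hmin).
    assert (Hrep : forall k, repeats_after x k <-> rep (shift 1 x) k).
    { intros k. split; intros [Hk H]; split; try assumption.
      - intros i. apply (H (1 + i)%nat). lia.
      - intros [|i] Hi; [lia | apply (H i)]. }
    exists (shift 1 x). split; [intros i; apply (Hx (1 + i)%nat); lia |].
    split; [now apply Hrep |]. intros k Hk. now apply Hmin, Hrep.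
  - intros (y & Hy & Hp & Hmin).
    (* At index 0 [Nat.pred] yields the junk value [y 0], which no condition from index 1 on
       sees. *)
    assert (Hrep : forall k, repeats_after (fun n => y (Nat.pred n)) k <-> rep y k).
    { intros k. split; intros [Hk H]; split; try assumption.
      - intros i. apply (H (S i)). lia.
      - intros [|i] Hi; [lia | apply (H i)]. }
    exists (fun n => y (Nat.pred n)). split; [intros [|i] Hi; [lia | apply (Hy i)] |].
    split; [now apply Hrep |]. intros k Hk. now apply Hmin, Hrep.
Qed.

Theorem theorem1 :
  forall p : nat,
    Per_F4 p <->
    (p = 1 \/ p = 8 \/ p = 11 \/
     exists a b : nat,
       1 <= a /\ 1 <= b /\ Nat.gcd a b = 1 /\ 2 * a + 1 <= b /\
       p = 10 * a + 11 * b)%nat.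
Proof.
  intros p. rewrite Per_F4_iff. split.
  - intros (y & HR & Hp). now apply minrep_values with y.
  - intros [-> | [-> | [-> | (a & b & Ha & _ & Hg & Hb & ->)]]];
      eexists; (split; [apply sol_Rec |]).
    + apply minrep_sol_1.
    + apply minrep_sol_8.
    + apply minrep_sol_11.
    + now apply minrep_sol_curve.
Qed.
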